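(* Let $(V,\wedge)$ be a real anticommutative algebra of finite dimension $\ge1$, let $(\cdot|\cdot)$ be a negative definite symmetric bilinear form on $V$, and let $\varphi$ be an automorphism of the vector space $V$ with adjoint $\varphi^*$ with respect to $(\cdot|\cdot)$. Define a product $\Delta$ on $V$ by $x\Delta y=\varphi^*\big(\varphi(x)\wedge\varphi(y)\big)$ for $x,y\in V$. Then the algebra $(V,(\cdot|\cdot),\wedge)$ is a flexible linear division algebra if and only if the algebra $(V,(\cdot|\cdot),\Delta)$ is a flexible linear division algebra.
   Context: For an anticommutative bilinear product $\ast$ on a real vector space $V$ and a symmetric bilinear form $(\cdot|\cdot)$ on $V$, $(V,(\cdot|\cdot),\ast)$ denotes the real algebra $\mathbb{R}\oplus V$ with product $(\alpha+x)(\beta+y)=(\alpha\beta+(x|y))+(\alpha y+\beta x+x\ast y)$ for $\alpha,\beta\in\mathbb{R}$, $x,y\in V$. The adjoint $\varphi^*$ is defined by $(\varphi(x)|y)=(x|\varphi^*(y))$. An algebra is flexible if $(xy)x=x(yx)$ for all $x,y$. An algebra $A\ne\{0\}$ is a linear division algebra if for every nonzero $x$ the maps $y\mapsto xy$ and $y\mapsto yx$ are bijective. *)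

(* Defs.v *)
From mathcomp Require Import all_boot all_order all_algebra.
From mathcomp Require Import reals.

Set Implicit Arguments.
Unset Strict Implicit.
Unset Printing Implicit Defensive.

Import Order.TTheory GRing.Theory Num.Theory.
Local Open Scope ring_scope.

(* MathComp's algebra structures are associative and unital, so an arbitrary
   algebra is represented by its carrier and its product. *)

Definition anticommutative (V : zmodType) (op : V -> V -> V) : Prop :=
  forall x y, op x y = - op y x.

Definition flexible (A : Type) (mul : A -> A -> A) : Prop :=
  forall x y, mul (mul x y) x = mul x (mul y x).

Definition linear_division (A : zmodType) (mul : A -> A -> A) : Prop :=
  (exists a : A, a != 0) /\
  (forall x : A, x != 0 ->
     bijective (fun y => mul x y) /\ bijective (fun y => mul y x)).

Definition negative_definite (R : realType) (V : lmodType R) (B : V -> V -> R)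
  : Prop := forall x, x != 0 -> B x x < 0.

Definition is_adjoint (R : realType) (V : lmodType R) (B : V -> V -> R)
    (phi phiadj : V -> V) : Prop :=
  forall x y, B (phi x) y = B x (phiadj y).

(* The product of (V, B, op), with the pair (alpha, x) standing for alpha + x. *)
Definition scalar_ext_mul (R : realType) (V : lmodType R)
    (B : V -> V -> R) (op : V -> V -> V) (a b : R^o * V) : R^o * V :=
  (a.1 * b.1 + B a.2 b.2, a.1 *: b.2 + b.1 *: a.2 + op a.2 b.2).

Definition flexible_linear_division (A : zmodType) (mul : A -> A -> A) : Prop :=
  flexible mul /\ linear_division mul.

(* Main.v *)
(** The algebra (V, B, op) is flexible iff B (op x y) x = 0 identically. In that
    case, as B is negative definite, it is a division algebra iff op x y = 0
    forces x and y to be linearly dependent: if (a + x)(b + y) = 0, pairing the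
    vector part with x gives (a^2 - B x x) b = 0, hence b = 0 unless a + x = 0,
    and pairing it with y then gives a B y y = 0, so y = 0 or a = 0; if a = 0,
    then y is both proportional and B-orthogonal to x, so again y = 0. Both conditions transfer
    between op and Delta along phi. *)
Require Import Defs.
From mathcomp Require Import all_boot all_order all_algebra.
From mathcomp Require Import reals.
From HB Require Import structures.

Set Implicit Arguments.
Unset Strict Implicit.
Unset Printing Implicit Defensive.

Import Order.TTheory GRing.Theory Num.Theory.
Local Open Scope ring_scope.

(** By rank-nullity, an injective endomorphism of a finite-dimensional space is onto. Taking a bare
    function with a linearity proof suits the multiplication maps of the extended algebra. *)
Lemma linear_ker0_bijective (K : fieldType) (W : vectType K) (f : W -> W) :
  linear f -> (forall v, f v = 0 -> v = 0) -> bijective f.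
Proof.
move=> f_lin f_ker0.
pose fM := GRing.isLinear.Build K W W *:%R f f_lin.
pose fL : {linear W -> W} := HB.pack f fM.
have kf : lker (linfun fL) == 0%VS.
  by apply/lker0P => v w; rewrite !lfunE; exact: raddf_inj.
exists (linfun fL)^-1%VF => v.
  by rewrite -[f v](lfunE fL) lker0_lfunK.
by rewrite -[LHS](lfunE fL) lker0_lfunVK.
Qed.

Section ScalarExtension.
Variables (R : realType) (V : vectType R) (B : {symmetric V}).

Lemma symC x y : B x y = B y x.
Proof. by rewrite hermC expr0 mul1r. Qed.

Lemma negative_definite_eq0 (B_neg : negative_definite B) x :
  B x x = 0 -> x = 0.
Proof. by move=> Bx0; apply: contraPeq Bx0 => /B_neg /lt_eqF/eqP. Qed.

Section Product.
Variables (op : {bilinear V -> V -> V}).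
Hypothesis op_anti : anticommutative op.

Lemma anticommutative_diag x : op x x = 0.
Proof.
apply/eqP; have /eqP := op_anti x x.
by rewrite -addr_eq0 -mulr2n -scaler_nat scaler_eq0 pnatr_eq0.
Qed.

(** For pure vectors the scalar parts of (xy)x and x(yx) are opposite, hence both zero under
    flexibility. Conversely, the vector parts agree since anticommutativity gives
    [op (op x y) x = op x (op y x)]. *)
Lemma flexible_scalar_extP :
  flexible (scalar_ext_mul B op) <-> (forall x y, B (op x y) x = 0).
Proof.
split=> [flex x y | Bop0 [a x] [b y]].
  have := congr1 fst (flex (0, x) (0, y)).
  rewrite /scalar_ext_mul /= !(mul0r, mulr0, scale0r, add0r) (symC x).
  rewrite [op y x]op_anti linearNl => /eqP.
  by rewrite -addr_eq0 -mulr2n mulrn_eq0 => /eqP.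
rewrite /scalar_ext_mul /=; congr pair.
  rewrite (symC x (_ + _ + _)) [op y x]op_anti (symC y x).
  rewrite !linearDl !linearNl /= Bop0 oppr0 !addr0 mulrDl mulrDr.
  rewrite (mulrC b a) (mulrC (B x y)) (addrC (B (a *: y) x)).
  by congr (_ + _ + _); exact: mulrC.
rewrite [op x (b *: _ + _ + _)]op_anti [op y x]op_anti (symC y x) (mulrC b a).
rewrite !linearDl !linearZl_LR !linearNl /= [op y x]op_anti.
rewrite anticommutative_diag !scaler0 !addr0 !scalerDr !scalerN.
rewrite !opprD !opprK oppr0 add0r -!addrA addNKr.
rewrite (addrCA ((a * b + _) *: x) (a *: op x y)) addKr.
by rewrite addrCA [RHS]addrCA; congr (_ + _); rewrite addrCA.
Qed.

Lemma scalar_ext_mul_linear u : linear (scalar_ext_mul B op u).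
Proof.
case: u => a x; move=> k [b y] [c z].
(* Viewing the scalars in [R] rather than [R^o] lets scaling be read as multiplication. *)
move: (a : R) (b : R) (c : R) => {}a {}b {}c.
congr pair => /=.
  rewrite -[LHS]/(a * (k * b + c) + B x (k *: y + z)).
  rewrite -[RHS]/(k * (a * b + B x y) + (a * c + B x z)).
  by rewrite linearPr /= !mulrDr addrACA mulrCA -!addrA.
rewrite -[LHS]/(a *: (k *: y + z) + (k * b + c) *: x + op x (k *: y + z)).
rewrite -[RHS]/(k *: (a *: y + b *: x + op x y) + (a *: z + c *: x + op x z)).
rewrite linearPr /= !scalerDr scalerDl !scalerA (mulrC k a).
by rewrite [in RHS]addrACA [X in _ = X + _]addrACA.
Qed.

Lemma scalar_ext_mul_eq0 (B_neg : negative_definite B)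
    (Bop0 : forall x y, B (op x y) x = 0)
    (dep : forall x y, x != 0 -> op x y = 0 -> exists k, y = k *: x)
    (u v : R^o * V) :
  u != 0 -> scalar_ext_mul B op u v = 0 -> v = 0.
Proof.
case: u v => [a x] [b y] u0 [/= e1 e2].
have b0 : b = 0.
  have [x0|x_neq0] := eqVneq x 0.
    move: u0 e1; rewrite x0 linear0l addr0 => u0 /eqP; rewrite mulf_eq0.
    by case/orP=> /eqP // a0; rewrite a0 eqxx in u0.
  have := congr1 (fun z => B z x) e2; rewrite /= linear0l !linearDl /= Bop0.
  rewrite !linearZl_LR /= addr0 (symC y x).
  (* Substituting [B x y = - (a * b)] leaves [b * (B x x - a * a) = 0], whose second factor is
     negative. *)
  move/eqP: e1; rewrite addrC addr_eq0 => /eqP ->.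
  rewrite mulrN mulrA addrC (mulrC _ b) -mulrBr => /eqP.
  rewrite mulf_eq0 => /orP[/eqP //|]; rewrite lt_eqF // subr_lt0.
  by rewrite (lt_le_trans (B_neg _ x_neq0)) // -expr2 sqr_ge0.
subst b; congr pair.
move: e1 e2; rewrite mulr0 scale0r add0r addr0 => Bxy e2.
apply/eqP/negPn/negP => y_neq0.
have a0 : a = 0.
  have := congr1 (fun z => B z y) e2; rewrite /= linear0l linearDl /=.
  rewrite [op x y]op_anti linearNl /= Bop0 oppr0 addr0 linearZl_LR /= => /eqP.
  by rewrite mulf_eq0 (lt_eqF (B_neg _ y_neq0)) orbF => /eqP.
subst a; rewrite scale0r add0r in e2.
have x_neq0 : x != 0 by apply: contraNneq u0 => ->.
have [k yk] := dep _ _ x_neq0 e2.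
move: Bxy y_neq0; rewrite yk linearZr_LR /= => /eqP.
rewrite mulf_eq0 (lt_eqF (B_neg _ x_neq0)) orbF => /eqP ->.
by rewrite scale0r eqxx.
Qed.

Lemma linear_division_scalar_ext (B_neg : negative_definite B) :
    (forall x y, B (op x y) x = 0) ->
  linear_division (scalar_ext_mul B op) <->
  (forall x y, x != 0 -> op x y = 0 -> exists k, y = k *: x).
Proof.
move=> Bop0; have opxx := anticommutative_diag.
split=> [[_ div] x y x0 opxy | dep].
  have xX0 : (0, x) != 0 :> R^o * V by rewrite xpair_eqE (negPf x0) andbF.
  have [/bij_inj inj _] := div _ xX0.
  (* This is the coefficient of the orthogonal projection of [y] onto [x]. The remainder is
     [B]-orthogonal to [x] and killed by [op x], so [(0, x)] annihilates it. *)
  exists (B x y / B x x); apply/eqP; rewrite -subr_eq0; apply/eqP.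
  have Bxx : B x x != 0 by rewrite lt_eqF // B_neg.
  suff /inj[] : scalar_ext_mul B op (0, x) (0, y - (B x y / B x x) *: x) =
    scalar_ext_mul B op (0, x) 0 by [].
  rewrite /scalar_ext_mul /= !(mul0r, mulr0, scale0r, scaler0, add0r).
  rewrite !linearBr /= !linearZr_LR /= opxy opxx scaler0 subr0 !linear0r.
  by rewrite divfK // subrr.
split=> [|[a x] ax0].
  by exists (1, 0); rewrite xpair_eqE oner_eq0.
have left_bij (u : R^o * V) : u != 0 -> bijective (scalar_ext_mul B op u).
  move=> u0; apply: linear_ker0_bijective; first exact: scalar_ext_mul_linear.
  by move=> v; exact: scalar_ext_mul_eq0.
(* Conjugation is an anti-automorphism, which reduces right multiplications
   to left ones. *)
pose conj (u : R^o * V) : R^o * V := (u.1, - u.2).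
have conjK : involutive conj by case=> b y; rewrite /conj /= opprK.
have conj_bij := inv_bij conjK.
split; first exact: left_bij.
have conj_neq0 : conj (a, x) != 0.
  by rewrite -[0]conjK (inj_eq (bij_inj conj_bij)) /conj /= oppr0.
apply: (eq_bij (bij_comp conj_bij (bij_comp (left_bij _ conj_neq0) conj_bij))).
case=> b y; rewrite /conj /scalar_ext_mul /=.
rewrite !linearNl !linearNr !opprK /= (symC x) [op x y]op_anti mulrC.
by rewrite !scalerN -!opprD !opprK (addrC (a *: y)).
Qed.

End Product.
End ScalarExtension.

(** If [phiadj x = phiadj y], then [x - y] is orthogonal to the image of [phi], which is all of [V],
    hence to itself. *)
Lemma adjoint_inj (R : realType) (V : vectType R) (B : {symmetric V})
    (phi phiadj : V -> V) :
  negative_definite B -> is_adjoint B phi phiadj -> bijective phi ->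
  injective phiadj.
Proof.
move=> B_neg adj [psi _ psiK] x y xy; apply/eqP; rewrite -subr_eq0; apply/eqP.
apply: (negative_definite_eq0 B_neg).
by rewrite -{1}[x - y]psiK linearBr /= !adj xy subrr.
Qed.

(** The defect of linearity is orthogonal to every vector, in particular to itself. *)
Lemma adjoint_linear (R : realType) (V : vectType R) (B : {symmetric V})
    (phi phiadj : V -> V) :
  negative_definite B -> is_adjoint B phi phiadj -> linear phiadj.
Proof.
move=> B_neg adj k x y; apply/eqP; rewrite -subr_eq0; apply/eqP.
apply: (negative_definite_eq0 B_neg); set z := (X in B X _).
by rewrite linearBr linearPr /= -!adj linearPr /= subrr.
Qed.

Theorem proposition4p1 (R : realType) (V : vectType R)
    (wedge : {bilinear V -> V -> V}) (B : {symmetric V})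
    (phi : {linear V -> V}) (phiadj : V -> V)
    (dimV : (1 <= \dim {:V})%N)
    (wedge_anti : anticommutative wedge)
    (B_neg : negative_definite B)
    (phi_bij : bijective phi)
    (phi_adj : is_adjoint B phi phiadj) :
  let Delta := fun x y : V => phiadj (wedge (phi x) (phi y)) in
  flexible_linear_division (scalar_ext_mul B wedge) <->
  flexible_linear_division (scalar_ext_mul B Delta).
Proof.
move=> Delta.
have adj_lin := adjoint_linear B_neg phi_adj.
have adj_inj := adjoint_inj B_neg phi_adj phi_bij.
pose adjM := GRing.isLinear.Build R V V *:%R phiadj adj_lin.
pose adjL : {linear V -> V} := HB.pack phiadj adjM.
(* Once bundled as the bilinear product [D], [Delta] falls under the same two criteria as
   [wedge]. *)
have Delta_bilinear : bilinear_for *:%R *:%R Delta.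
  split=> z k x y.
    by rewrite /Delta linearP linearPl -[LHS]/(adjL _) linearP.
  by rewrite /Delta linearP linearPr -[LHS]/(adjL _) linearP.
pose DeltaM := bilinear_isBilinear.Build R V V V *:%R *:%R Delta Delta_bilinear.
pose D : {bilinear V -> V -> V} := HB.pack Delta DeltaM.
have D_anti : anticommutative D.
  by move=> x y; rewrite -[LHS]/(adjL _) wedge_anti raddfN.
have -> : Delta = D by [].
(* Adjointness carries the flexibility criterion for [D] to that for [wedge] on the image of
   [phi]. *)
have BD x y : B (D x y) x = B (wedge (phi x) (phi y)) (phi x).
  by rewrite symC -[LHS]phi_adj symC.
(* Injectivity of [phiadj] matches the zero products; [phi] and its inverse [psi] then transport
   proportionality. *)
have D0 x y : D x y = 0 <-> wedge (phi x) (phi y) = 0.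
  split=> [|w0]; last by rewrite -[LHS]/(adjL _) w0 raddf0.
  by move=> D0; apply: adj_inj; rewrite -[RHS]/(adjL 0) raddf0.
have phi_inj := bij_inj phi_bij; have [psi phiK psiK] := phi_bij.
rewrite /flexible_linear_division.
rewrite (flexible_scalar_extP B wedge_anti) (flexible_scalar_extP B D_anti).
split=> -[flex div]; split.
- by move=> x y; rewrite BD.
- have flexD x y : B (D x y) x = 0 by rewrite BD.
  move/(linear_division_scalar_ext wedge_anti B_neg flex): div => dep.
  apply/(linear_division_scalar_ext D_anti B_neg flexD) => x y x0 /D0 w0.
  have phix0 : phi x != 0 by rewrite -(raddf0 phi) (inj_eq phi_inj).
  have [k yk] := dep _ _ phix0 w0.
  by exists k; apply: phi_inj; rewrite yk linearZ.
- by move=> x y; rewrite -[x]psiK -[y]psiK -BD.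
- have flexW x y : B (wedge x y) x = 0 by rewrite -[x]psiK -[y]psiK -BD.
  move/(linear_division_scalar_ext D_anti B_neg flex): div => dep.
  apply/(linear_division_scalar_ext wedge_anti B_neg flexW) => x y x0 w0.
  have psix0 : psi x != 0.
    by apply: contraNneq x0 => psix0; rewrite -[x]psiK psix0 raddf0.
  have /dep[//|k yk] : D (psi x) (psi y) = 0 by apply/D0; rewrite !psiK.
  by exists k; rewrite -[y]psiK yk linearZ /= psiK.
Qed.
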